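(* Let $d\ge 1$ and let $\mathbb{F}_{2^d}=\mathbb{Z}_2[x]/\langle g_2\rangle$ and $\mathbb{E}_{4^d}=\mathbb{Z}_4[x]/\langle g_4\rangle$, where $g_2\in\mathbb{Z}_2[x]$ is irreducible of degree $d$ and $g_4=\overline{g_2}$. Let $e\in\mathbb{E}_{4^d}[x_1,x_2,\ldots,x_m]$ be a polynomial and let $\underline{e}\in\mathbb{F}_{2^d}[x_1,x_2,\ldots,x_m]$ be obtained by projecting all the coefficients of monomials of $e$. Then, for all $\alpha_1,\alpha_2,\ldots,\alpha_m\in\mathbb{F}_{2^d}$, we have $$2\,\overline{\underline{e}(\alpha_1,\alpha_2,\ldots,\alpha_m)}=2\,e(\overline{\alpha_1},\overline{\alpha_2},\ldots,\overline{\alpha_m})$$ in $\mathbb{E}_{4^d}$.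
   Context: $\mathbb{Z}_m$ denotes the ring of integers modulo $m$. For $a\in\mathbb{Z}_2[x]$, the lift $\overline{a}\in\mathbb{Z}_4[x]$ is obtained by regarding the $\{0,1\}$-reduced coefficients of $a$ as elements $0,1$ of $\mathbb{Z}_4$. For $s\in\mathbb{Z}_4[x]$, the projection $\underline{s}\in\mathbb{Z}_2[x]$ is obtained by reducing each coefficient of $s$ modulo $2$. For $\alpha=a+\langle g_2\rangle\in\mathbb{F}_{2^d}$ with $a\in\mathbb{Z}_2[x]$, the lift of $\alpha$ is $\overline{\alpha}=\overline{a_{\mathrm r}}+\langle g_4\rangle\in\mathbb{E}_{4^d}$, where $a_{\mathrm r}$ is the remainder of the polynomial division of $a$ by $g_2$. For $\sigma=s+\langle g_4\rangle\in\mathbb{E}_{4^d}$ with $s\in\mathbb{Z}_4[x]$, the projection of $\sigma$ is $\underline{\sigma}=\underline{s}+\langle g_2\rangle\in\mathbb{F}_{2^d}$. Both maps are well defined. *)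

(* Defs.v *)
From HB Require Import structures.
From mathcomp Require Import all_boot all_order all_algebra.
From mathcomp.multinomials Require Import mpoly.

Set Implicit Arguments.
Unset Strict Implicit.
Unset Printing Implicit Defensive.

Import GRing.Theory.
Import Pdiv.CommonRing Pdiv.RingMonic Pdiv.Field.
Local Open Scope ring_scope.

(* [c : nat] is the representative of [c] in {0, 1}, resp. {0, 1, 2, 3}. *)
Definition lift_coef (c : 'F_2) : 'Z_4 := (c : nat)%:R.
Definition proj_coef (c : 'Z_4) : 'F_2 := (c : nat)%:R.

Definition lift_poly (a : {poly 'F_2}) : {poly 'Z_4} := map_poly lift_coef a.
Definition proj_poly (s : {poly 'Z_4}) : {poly 'F_2} := map_poly proj_coef s.

(* [{poly %/ g}] is R[x]/<g> as soon as [g] is monic and nonconstant, and each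
   of its elements coerces to its unique representative of degree < deg g,
   that is, to the remainder modulo [g] of any other representative.  For [g2]
   irreducible this applies to [g2] and to [lift_poly g2] ([mk_monicF],
   [mk_monicE]); [elt_lift_in_qpoly] and [elt_proj_in_qpoly] describe the two
   maps on arbitrary representatives. *)
Definition elt_lift (g2 : {poly 'F_2}) (alpha : {poly %/ g2}) :
    {poly %/ lift_poly g2} :=
  in_qpoly (lift_poly g2) (lift_poly (alpha : {poly 'F_2})).

Definition elt_proj (g2 : {poly 'F_2}) (sigma : {poly %/ lift_poly g2}) :
    {poly %/ g2} :=
  in_qpoly g2 (proj_poly (sigma : {poly 'Z_4})).

Lemma lift_coefK : cancel lift_coef proj_coef.
Proof. by case=> [[|[|[]]] // ?]; apply: val_inj. Qed.

Lemma lift_polyK : cancel lift_poly proj_poly.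
Proof. by apply: map_polyK => //; exact: lift_coefK. Qed.

Fact proj_coef_is_zmod_morphism : zmod_morphism proj_coef.
Proof.
by case=> [[|[|[|[|[]]]]] // ?]; case=> [[|[|[|[|[]]]]] // ?]; apply: val_inj.
Qed.

Fact proj_coef_is_monoid_morphism : monoid_morphism proj_coef.
Proof.
split; first exact: val_inj.
by case=> [[|[|[|[|[]]]]] // ?]; case=> [[|[|[|[|[]]]]] // ?]; apply: val_inj.
Qed.

HB.instance Definition _ :=
  GRing.isZmodMorphism.Build 'Z_4 'F_2 proj_coef proj_coef_is_zmod_morphism.
HB.instance Definition _ :=
  GRing.isMonoidMorphism.Build 'Z_4 'F_2 proj_coef proj_coef_is_monoid_morphism.

Section Quotients.

Variable g2 : {poly 'F_2}.
Hypothesis g2_irr : irreducible_poly g2.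

Lemma size_lift_poly (a : {poly 'F_2}) : size (lift_poly a) = size a.
Proof.
have [->|a0] := eqVneq a 0; first by rewrite /lift_poly map_poly0 !size_poly0.
apply: size_map_poly_id0; apply/eqP => h0.
by move: a0; rewrite -lead_coef_eq0 -(lift_coefK (lead_coef a)) h0 rmorph0 eqxx.
Qed.

Lemma irr_monic : g2 \is monic.
Proof.
have g0 : g2 != 0 by apply: irredp_neq0.
move: g0; rewrite monicE -lead_coef_eq0.
by case: (lead_coef g2) => [[|[|[]]]].
Qed.

Lemma lift_monic : lift_poly g2 \is monic.
Proof.
rewrite monicE lead_coefE size_lift_poly /lift_poly coef_map_id0 //.
by rewrite -lead_coefE (monicP irr_monic).
Qed.

Lemma mk_monicF : mk_monic g2 = g2.
Proof. by rewrite /mk_monic irr_monic g2_irr.1. Qed.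

Lemma mk_monicE : mk_monic (lift_poly g2) = lift_poly g2.
Proof. by rewrite /mk_monic lift_monic size_lift_poly g2_irr.1. Qed.

Lemma elt_lift_in_qpoly (a : {poly 'F_2}) :
  elt_lift (in_qpoly g2 a) = in_qpoly (lift_poly g2) (lift_poly (a %% g2)).
Proof.
by rewrite /elt_lift /= mk_monicF -Pdiv.IdomainMonic.modpE ?irr_monic.
Qed.

Lemma elt_proj_in_qpoly (s : {poly 'Z_4}) :
  elt_proj (in_qpoly (lift_poly g2) s) = in_qpoly g2 (proj_poly s).
Proof.
apply: val_inj; rewrite /elt_proj /= mk_monicE mk_monicF.
rewrite [s in RHS](rdivp_eq lift_monic) /proj_poly rmorphD rmorphM /=.
rewrite -/(proj_poly (lift_poly g2)) lift_polyK.
by rewrite rmodpD ?rmodp_mull ?irr_monic // add0r.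
Qed.

End Quotients.

(* Main.v *)
(** Projection is a ring morphism splitting the lift, so both arguments of
    [2 *] project to the same element of the residue field; they differ by an
    element all of whose coefficients lie in 2 Z_4, and doubling kills it. *)
From HB Require Import structures.
Require Import Defs.
From mathcomp Require Import all_boot all_order all_algebra.
From mathcomp.multinomials Require Import mpoly.

Set Implicit Arguments.
Unset Strict Implicit.
Unset Printing Implicit Defensive.

Import GRing.Theory.
Local Open Scope ring_scope.

(** Both sides expand over the same monomials, those of degree below [msize p], and agree term by
    term. This is what moves the projection inside the evaluation of [e]. *)
Lemma rmorph_meval (n : nat) (R S : comNzRingType) (f : {rmorphism R -> S})
    (p : {mpoly R[n]}) (v : 'I_n -> R) :
  f p.@[v] = (map_mpoly f p).@[fun i => f (v i)].
Proof.
rewrite (map_mpolyE f (leqnn (msize p))) [in LHS](mpolywE (leqnn (msize p))).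
rewrite (raddf_sum (meval v)) (raddf_sum (meval _)) (raddf_sum f).
apply: eq_bigr => k _ /=.
rewrite !mevalZ !mevalX rmorphM rmorph_prod /=; congr (_ * _).
by apply: eq_bigr => i _; rewrite rmorphXn.
Qed.

Lemma in_qpolyK (R : nzRingType) (h : {poly R}) (q : {poly %/ h}) :
  in_qpoly h q = q.
Proof. exact/val_inj/in_qpoly_small/size_mk_monic. Qed.

Lemma proj_coef_eq0_double (c : 'Z_4) : proj_coef c = 0 -> c *+ 2 = 0.
Proof. by case: c => [[|[|[|[|[]]]]] // ?] // _; apply: val_inj. Qed.

Section Projection.

Variable g2 : {poly 'F_2}.
Hypothesis g2_irr : irreducible_poly g2.

Lemma elt_proj_is_zmod_morphism : zmod_morphism (@elt_proj g2).
Proof.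
by move=> s t; rewrite /elt_proj /proj_poly !raddfB.
Qed.

Lemma elt_proj_is_monoid_morphism : monoid_morphism (@elt_proj g2).
Proof.
split=> [|s t].
  by rewrite -in_qpoly1 elt_proj_in_qpoly // /proj_poly rmorph1 in_qpoly1.
(* Viewed as classes of their representatives, [s] and [t] multiply as polynomials, and the
   unreduced product can be projected directly. *)
rewrite -{1}[s]in_qpolyK -{1}[t]in_qpolyK -in_qpolyM elt_proj_in_qpoly //.
by rewrite /proj_poly rmorphM in_qpolyM.
Qed.

Lemma elt_liftK : cancel (@elt_lift g2) (@elt_proj g2).
Proof.
by move=> a; rewrite /elt_lift elt_proj_in_qpoly // lift_polyK in_qpolyK.
Qed.

Lemma elt_proj_eq0_double (s : {poly %/ lift_poly g2}) :
  elt_proj s = 0 -> s *+ 2 = 0.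
Proof.
(* The two moduli have equal size, so projecting a reduced representative leaves it reduced: a zero
   class then forces every coefficient to vanish mod 2. *)
have small : (size (proj_poly s) < size (mk_monic g2))%N.
  rewrite (leq_ltn_trans (size_poly _ _)) //.
  suff -> : size (mk_monic g2) = size (mk_monic (lift_poly g2)).
    exact: size_mk_monic.
  by rewrite mk_monicE // mk_monicF // size_lift_poly.
move=> /(congr1 val); rewrite [val _]in_qpoly_small //= => s0.
apply/val_inj/polyP => i.
rewrite raddfMn coefMn coef0; apply: proj_coef_eq0_double.
by rewrite -coef_map -/(proj_poly s) s0 coef0.
Qed.

Lemma eq_elt_proj_double (s t : {poly %/ lift_poly g2}) :
  elt_proj s = elt_proj t -> 2 * s = 2 * t.
Proof.
move=> st; apply/eqP; rewrite -subr_eq0 -mulrBr mulr_natl.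
by rewrite elt_proj_eq0_double // elt_proj_is_zmod_morphism st subrr.
Qed.

End Projection.

Theorem lemma5 (d m : nat) (g2 : {poly 'F_2}) (d_ge1 : (1 <= d)%N)
    (g2_irr : irreducible_poly g2) (g2_deg : size g2 = d.+1)
    (e : {mpoly {poly %/ lift_poly g2}[m]}) (alpha : 'I_m -> {poly %/ g2}) :
  2 * elt_lift (map_mpoly (@elt_proj g2) e).@[alpha] =
  2 * e.@[fun i => elt_lift (alpha i)].
Proof.
(* Multiplicativity of the projection rests on [g2_irr], so the morphism structure is packed
   locally. *)
pose projA := GRing.isZmodMorphism.Build _ _ (@elt_proj g2)
  (@elt_proj_is_zmod_morphism g2).
pose projM := GRing.isMonoidMorphism.Build _ _ (@elt_proj g2)
  (elt_proj_is_monoid_morphism g2_irr).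
pose proj : {rmorphism {poly %/ lift_poly g2} -> {poly %/ g2}} :=
  HB.pack (@elt_proj g2) projA projM.
apply: eq_elt_proj_double => //; rewrite elt_liftK //.
(* Only the evaluation points remain to be compared: [alpha i] and its lift projected back. *)
rewrite [RHS](rmorph_meval proj); apply: meval_eq => i.
by rewrite /= elt_liftK.
Qed.
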